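(* Let $X$ and $Y$ be real normed spaces, let $C\subseteq X$ be a convex cone, and let $E=\{e_1,e_2,\dots,e_n\}$ be a (finite) basis of $C$. If $\varphi:C\rightarrow c(Y)$ is a linear correspondence, then $\varphi$ is continuous.
   Context: A subset $C$ of a real normed space $X$ is a cone if $tC\subseteq C$ for every $t>0$. A linearly independent set $E$ is a basis of the cone $C$ if $C$ is exactly the set of all finite combinations $\lambda_1e_1+\dots+\lambda_ne_n$ with $e_i\in E$ and $\lambda_i\ge 0$. $c(Y)$ is the set of all nonempty compact subsets of $Y$; $\varphi:C\to c(Y)$ denotes a correspondence (set-valued map) assigning to each $x\in C$ a set $\varphi(x)\in c(Y)$. It is linear if $\varphi(x+y)=\varphi(x)+\varphi(y)$ and $\varphi(\lambda x)=\lambda\varphi(x)$ for all $x,y\in C$, $\lambda>0$. A correspondence $\varphi$ is upper semicontinuous at $x\in C$ if for every neighborhood $U$ of the set $\varphi(x)$ there is a neighborhood $V$ of $x$ in $C$ with $\varphi(z)\subseteq U$ for all $z\in V$; lower semicontinuous at $x$ if for every open set $U$ with $\varphi(x)\cap U\ne\emptyset$ there is a neighborhood $V$ of $x$ in $C$ with $\varphi(z)\cap U\neq\emptyset$ for all $z\in V$; continuous if it is both at every point of $C$. (For compact-valued correspondences this is equivalent to continuity as a map into $c(Y)$ with the Hausdorff metric.) *)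

(* Defs.v *)
From HB Require Import structures.
From mathcomp Require Import all_boot all_order all_algebra.
From mathcomp Require Import all_classical all_reals all_analysis.
Import Order.TTheory GRing.Theory Num.Theory.
Import numFieldNormedType.Exports.

Set Implicit Arguments.
Unset Strict Implicit.
Unset Printing Implicit Defensive.

Local Open Scope classical_set_scope.
Local Open Scope ring_scope.

Definition cone (R : realType) (X : normedModType R) (C : set X) : Prop :=
  forall t : R, 0 < t -> [set t *: x | x in C] `<=` C.

Definition linearly_independent (R : realType) (X : normedModType R)
    (E : set X) : Prop :=
  forall (n : nat) (e : 'I_n -> X) (l : 'I_n -> R),
    injective e -> (forall i, E (e i)) ->
    \sum_(i < n) l i *: e i = 0 -> forall i, l i = 0.

(* The empty combination (n = 0) is allowed, so [set0] is a basis of [set 0];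
   for nonempty E it adds nothing, all coefficients being allowed to vanish. *)
Definition cone_basis (R : realType) (X : normedModType R)
    (C E : set X) : Prop :=
  linearly_independent E /\
  C = [set x | exists (n : nat) (e : 'I_n -> X) (l : 'I_n -> R),
         [/\ forall i, E (e i), forall i, 0 <= l i
           & x = \sum_(i < n) l i *: e i]].

Definition nonempty_compacts (Y : topologicalType) : set (set Y) :=
  [set K | K !=set0 /\ compact K].

(* A correspondence on C is represented by a total map X -> set Y whose values
   outside C are irrelevant: below, every point at which phi is evaluated is
   required to lie in C, and neighborhoods are taken in the trace of the
   topology on C. *)
Definition compact_valued_on (R : realType) (X Y : normedModType R)
    (C : set X) (phi : X -> set Y) : Prop :=
  forall x, C x -> nonempty_compacts (phi x).

Definition linear_correspondence (R : realType) (X Y : normedModType R)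
    (C : set X) (phi : X -> set Y) : Prop :=
  (forall x y, C x -> C y ->
     phi (x + y) = [set u + v | u in phi x & v in phi y]) /\
  (forall (l : R) x, 0 < l -> C x -> phi (l *: x) = [set l *: u | u in phi x]).

Definition usc_at (R : realType) (X Y : normedModType R)
    (C : set X) (phi : X -> set Y) (x : X) : Prop :=
  forall U : set Y, set_nbhs (phi x) U ->
    \forall z \near within C (nbhs x), phi z `<=` U.

Definition lsc_at (R : realType) (X Y : normedModType R)
    (C : set X) (phi : X -> set Y) (x : X) : Prop :=
  forall U : set Y, open U -> phi x `&` U !=set0 ->
    \forall z \near within C (nbhs x), phi z `&` U !=set0.

Definition continuous_correspondence (R : realType) (X Y : normedModType R)
    (C : set X) (phi : X -> set Y) : Prop :=
  forall x, C x -> usc_at C phi x /\ lsc_at C phi x.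

(* Main.v *)
Require Import Defs.
From mathcomp Require Import all_boot all_order all_algebra.
From mathcomp Require Import all_classical all_reals all_analysis.
Import numFieldNormedType.Exports.
Import Order.TTheory GRing.Theory Num.Theory.

Set Implicit Arguments.
Unset Strict Implicit.
Unset Printing Implicit Defensive.

Local Open Scope classical_set_scope.
Local Open Scope ring_scope.

(** The correspondence is in fact Lipschitz for the Hausdorff distance.

    Linearity and compactness force [phi 0 = [set 0]]: the set [phi 0] is
    bounded and stable under all positive dilations. Hence the identity
    [phi (l *: x) = l *: phi x] extends to [l = 0], and linearity gives
    (image_conic_combination) that [phi (\sum_i l i *: e i)] consists of the
    sums [\sum_i l i *: u i] with [u i] in [phi (e i)], for all [l i >= 0].

    Two points [x = \sum_i l i *: e i] and [z = \sum_i m i *: e i] of the cone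
    can therefore be compared with the same choice of [u i]: the elements
    [\sum_i l i *: u i] of [phi x] and [\sum_i m i *: u i] of [phi z] differ by
    at most [\sum_i `|l i - m i| * `|u i|]. The [u i] range over bounded sets,
    and since the basis is finite and linearly independent, the coordinates
    [l i - m i] are bounded by a constant multiple of [`|x - z|]
    (coordinate_bound). So every element of [phi x] is within [K * `|x - z|]
    of some element of [phi z]; for compact values such an estimate yields both
    semicontinuities (lipschitz_correspondence). *)

(** A Lebesgue number argument: each point of [K] has a ball inside [U], half
    of its radius serves all points of the half-size ball, and compactness makes
    finitely many half-size balls suffice. *)
Lemma compact_thickening (R : realType) (Y : normedModType R) (K U : set Y) :
  compact K -> set_nbhs K U ->
  \forall e \near (0 : R)^'+, forall y z, K y -> `|y - z| < e -> U z.
Proof.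
move=> /compact_near_coveringP cK KU.
suff : \forall e \near (0 : R)^'+,
    K `<=` (fun y => forall z, `|y - z| < e -> U z).
  by apply: filterS => e KeU y z Ky; exact: KeU.
apply: cK => y Ky.
have /nbhs_normP[r /= r0 yrU] := KU y Ky.
exists (ball y (r / 2), [set e : R | e < r / 2]).
  split; first by apply: nbhsx_ballx; rewrite divr_gt0.
  by apply: nbhs_right_lt; rewrite divr_gt0.
move=> [y' e] /= [yy' er] z y'z; apply: yrU => /=.
rewrite -(subrKA y') (le_lt_trans (ler_normD _ _))// [r]splitr ltrD//.
  by move: yy'; rewrite -ball_normE.
exact: lt_trans er.
Qed.

(** Exchanging [x] and [z] in the hypothesis bounds both one-sided Hausdorff
    distances. Upper semicontinuity uses the bound from [phi z] to [phi x] and a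
    uniform thickening of [phi x]; lower semicontinuity uses the bound from
    [phi x] to [phi z] and one ball around a point of [phi x `&` U]. *)
Lemma lipschitz_correspondence (R : realType) (X Y : normedModType R)
    (C : set X) (phi : X -> set Y) (K : R) :
  compact_valued_on C phi ->
  (forall x z u, C x -> C z -> phi x u ->
     exists2 v, phi z v & `|u - v| <= K * `|x - z|) ->
  continuous_correspondence C phi.
Proof.
move=> cphi Klip.
have close (x : X) (e : R) : 0 < e -> \forall z \near x, K * `|x - z| < e.
  move=> e0.
  have: K * `|x - z| @[z --> x] --> K * `|x - x|.
    apply: cvgM; first exact: cvg_cst.
    by apply: cvg_norm; apply: cvgB; [exact: cvg_cst|exact: cvg_id].
  by rewrite subrr normr0 mulr0 => /cvgr_lt; apply.
move=> x Cx; split=> U.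
  move=> xU; have [_ cx] := cphi x Cx.
  have /(_ _)/filter_ex[] := filterI (compact_thickening cx xU) (nbhs_right_gt 0).
  move=> e [eU e0].
  apply: filterS (close x e e0) => z xz Cz v zv.
  have [u xu uv] := Klip z x v Cz Cx zv.
  apply: (eU u) => //; rewrite distrC (le_lt_trans uv)//.
  by rewrite distrC.
move=> oU [u [xu Uu]].
have /nbhs_normP[e /= e0 eU] := open_nbhs_nbhs (conj oU Uu).
apply: filterS (close x e e0) => z xz Cz.
have [v zv uv] := Klip x z u Cx Cz xu.
by exists v; split => //; apply: eU => /=; exact: le_lt_trans xz.
Qed.

(** A nonzero [u] in [K] could be dilated inside [K] to a vector of norm
    [M + 1], where [M] bounds [K]. *)
Lemma compact_scale_invariant (R : realType) (Y : normedModType R)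
    (K : set Y) :
  compact K -> (forall l, 0 < l -> [set l *: u | u in K] `<=` K) ->
  K `<=` [set 0].
Proof.
move=> /compact_bounded /pinfty_ex_gt0[M M0 KM] Kl u Ku /=.
apply/eqP/negPn/negP => u0.
have nu0 : 0 < `|u| by rewrite normr_gt0.
have t0 : 0 < (M + 1) / `|u| by rewrite divr_gt0// addr_gt0.
have /KM /= : K ((M + 1) / `|u| *: u) by apply: (Kl _ t0); exists u.
rewrite normrZ gtr0_norm// mulfVK ?gt_eqF//.
by rewrite gerDl ler10.
Qed.

(** The sum is twice the midpoint. *)
Lemma cone_add (R : realType) (X : normedModType R) (C : set X) x y :
  cone C -> convex_set C -> C x -> C y -> C (x + y).
Proof.
move=> coneC convC Cx Cy.
have half01 : (2^-1 : R) <= 1 by rewrite invf_le1 ?ler1n.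
have half0 : 0 <= (2^-1 : R) by rewrite invr_ge0.
have := convC x y (Itv01 half0 half01).
rewrite !inE => /(_ Cx Cy) Cm.
suff -> : x + y = 2 *: (2^-1 *: x + (1 - 2^-1) *: y).
  by apply: (coneC 2 (ltr0n _ 2)); exists (2^-1 *: x + (1 - 2^-1) *: y).
have -> : 1 - 2^-1 = 2^-1 :> R 
  by rewrite [X in X - _](splitr 1) mul1r addrK.
by rewrite -scalerDr scalerA divff ?scale1r// pnatr_eq0.
Qed.

(** Induction on [n]. Coefficients may vanish although homogeneity is assumed
    only for positive scalars; this is where [phi 0 = [set 0]] is needed. The
    membership of the sum in [C] is proved along, because additivity of [phi]
    applies only to points of [C]. *)
Lemma image_conic_combination (R : realType) (X Y : normedModType R)
    (C : set X) (phi : X -> set Y) :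
  cone C -> convex_set C -> C 0 ->
  compact_valued_on C phi -> linear_correspondence C phi ->
  forall (n : nat) (e : 'I_n -> X) (l : 'I_n -> R),
    (forall i, C (e i)) -> (forall i, 0 <= l i) ->
    C (\sum_i l i *: e i) /\
    phi (\sum_i l i *: e i) =
      [set \sum_i l i *: u i | u in [set u | forall i, phi (e i) (u i)]].
Proof.
move=> coneC convC C0 cphi [phiD phiZ].
have phi0 : phi 0 = [set 0].
  have [[u0 phiu0] cphi0] := cphi 0 C0.
  have phi0sub : phi 0 `<=` [set 0].
    apply: compact_scale_invariant cphi0 _ => l l0.
    by rewrite -phiZ// scaler0.
  apply/seteqP; split=> // _ ->.
  by rewrite -(phi0sub _ phiu0).
have phiZ0 l x : 0 <= l -> C x ->
    C (l *: x) /\ phi (l *: x) = [set l *: u | u in phi x].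
  move=> l0 Cx; have [->|ln0] := eqVneq l 0; last first.
    have lp : 0 < l by rewrite lt_def ln0.
    by split; [apply: (coneC l lp); exists x|exact: phiZ].
  rewrite scale0r; split=> //; rewrite phi0.
  have [[u xu] _] := cphi x Cx.
  by apply/seteqP; split=> [_ ->|_ [v _ <-]] /=; [exists u|]; rewrite ?scale0r.
elim=> [|n IHn] e l Ce l0.
  rewrite big_ord0; split=> //; rewrite phi0.
  apply/seteqP; split=> [_ ->|_ [u _ <-]] /=; last by rewrite big_ord0.
  by exists (fun=> 0); [case|rewrite big_ord0].
have [CS phiS] := IHn (e \o lift ord0) (l \o lift ord0)
  (fun i => Ce _) (fun i => l0 _).
have [C1 phi1] := phiZ0 _ _ (l0 ord0) (Ce ord0).
rewrite big_ord_recl; split; first exact: cone_add.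
rewrite phiD// phi1 phiS; apply/seteqP; split=> v /=.
  move=> [_ [u0 eu0 <-]] [_ [u eu <-] <-].
  exists (fun i => if unlift ord0 i is Some j then u j else u0).
    by move=> i; case: unliftP => [j ->|->].
  rewrite big_ord_recl unlift_none; congr (_ + _).
  by apply: eq_bigr => i _; rewrite liftK.
move=> [u eu <-]; rewrite big_ord_recl.
exists (l ord0 *: u ord0); first by exists (u ord0).
by exists (\sum_i l (lift ord0 i) *: u (lift ord0 i)); [exists (u \o lift ord0)|].
Qed.

(** On the compact unit sphere of the coordinate space, the continuous function
    [v |-> `|\sum_j v 0 j *: e j|] attains its minimum, which is positive by
    linear independence; homogeneity then gives the bound, with the inverse of
    that minimum as the constant. *)
Lemma coordinate_bound (R : realType) (X : normedModType R) (n : nat)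
    (e : 'I_n -> X) :
  (forall l : 'I_n -> R, \sum_i l i *: e i = 0 -> forall i, l i = 0) ->
  exists2 c : R, 0 <= c &
    forall (l : 'I_n -> R) i, `|l i| <= c * `|\sum_j l j *: e j|.
Proof.
move=> free_e.
pose f (v : 'rV[R]_n) := \sum_j v 0 j *: e j.
have f_cont : continuous f.
  apply: continuous_big; first exact: add_continuous.
  by move=> i _ v; apply: (@cvgZr_tmp _ _ _ (nbhs v)); exact: coord_continuous.
have entry_le (v : 'rV[R]_n) i : `|v 0 i| <= `|v|.
  rewrite [leRHS]/Num.norm /= mx_normrE; apply/bigmax_geP; right => /=.
  by exists (0, i).
have fZ a (v : 'rV[R]_n) : f (a *: v) = a *: f v.
  by rewrite scaler_sumr; apply: eq_bigr => i _; rewrite mxE scalerA.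
pose S := [set v : 'rV[R]_n | `|v| = 1].
have normalized v : v != 0 -> S (`|v|^-1 *: v).
  move=> v0; rewrite /S /= normrZ ger0_norm ?invr_ge0// mulVf//.
  by rewrite normr_eq0.
suff [c c0 cf] : exists2 c, 0 <= c & forall v, `|v| <= c * `|f v|.
  exists c => // l i; have := cf (\row_j l j).
  have -> : f (\row_j l j) = \sum_j l j *: e j.
    by apply: eq_bigr => j _; rewrite mxE.
  by apply: le_trans; have := entry_le (\row_j l j) i; rewrite mxE.
(* The sphere is empty when [n = 0], and no minimum is attained then. *)
have [[v0 Sv0]|S0] := pselect (S !=set0); last first.
  exists 0 => // v; rewrite mul0r.
  have [->|/normalized Sv] := eqVneq v 0; first by rewrite normr0.
  by case: S0; exists (`|v|^-1 *: v).
have cS : compact S.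
  apply: bounded_closed_compact.
    by exists 1; split=> // M M1 v /= ->; exact: ltW.
  apply: (@preimage_closed _ _ (fun v : 'rV[R]_n => `|v|) [set 1]).
    by move=> v _; exact: norm_continuous.
  exact: closed_eq.
have [|w Sw wmin] := @EVT_min_rV R n (fun v => `|f v|) S (ex_intro _ v0 Sv0) cS.
  apply: continuous_subspaceT => v; apply: continuous_comp; first exact: f_cont.
  exact: norm_continuous.
have fw0 : 0 < `|f w|.
  rewrite normr_gt0; apply/eqP => /free_e w0.
  move: Sw; rewrite inE /S /=.
  have -> : w = 0 by apply/rowP => i; rewrite mxE w0.
  by rewrite normr0 => /esym/eqP; rewrite oner_eq0.
exists (`|f w|^-1); first by rewrite invr_ge0.
move=> v; rewrite mulrC ler_pdivlMr//.
have [->|v0'] := eqVneq v 0; first by rewrite normr0 mul0r.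
have := wmin (`|v|^-1 *: v); rewrite inE => /(_ (normalized _ v0')).
rewrite fZ normrZ ger0_norm ?invr_ge0// mulrC ler_pdivlMr ?normr_gt0//.
by rewrite mulrC.
Qed.

(** The definition of a cone basis allows conic combinations of any length and
    with repeated vectors. For a finite [E] they can all be rewritten over one
    fixed injective enumeration [e], by collecting the coefficients of equal
    vectors; this gives two points of [C] coordinates that can be subtracted. *)
Lemma finite_cone_basis (R : realType) (X : normedModType R) (C E : set X) :
  finite_set E -> cone_basis C E ->
  exists (n : nat) (e : 'I_n -> X),
    [/\ forall i, C (e i),
        forall l : 'I_n -> R, \sum_i l i *: e i = 0 -> forall i, l i = 0 &
        forall x, C x ->
          exists2 l : 'I_n -> R, (forall i, 0 <= l i) & x = \sum_i l i *: e i].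
Proof.
move=> /finite_seqP[s0 Es0] [freeE CE].
pose s := undup s0.
have sE x : E x <-> x \in s by rewrite Es0 mem_undup.
pose e (i : 'I_(size s)) := tnth (in_tuple s) i.
have Ee i : E (e i) by apply/sE; exact: mem_tnth.
have e_inj : injective e by apply/tuple_uniqP; rewrite undup_uniq.
exists (size s), e; split.
- move=> i; rewrite CE /=; exists 1%N, (fun=> e i), (fun=> 1).
  by split=> //; rewrite big_ord1 scale1r.
- by move=> l; exact: freeE.
move=> x; rewrite CE => -[m [d [k [Ed k0 ->]]]].
exists (fun i => \sum_(j < m | d j == e i) k j).
  by move=> i; exact: sumr_ge0.
under [RHS]eq_bigr => i _.
  rewrite scaler_suml.
  under eq_bigr => j /eqP <- do over.
  over.
rewrite (exchange_big_dep predT)//=; apply: eq_bigr => j _.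
have /sE /(tnthP (in_tuple s))[i di] := Ed j.
rewrite (bigD1 i) /=; last by rewrite di.
rewrite big1 ?addr0// => i' /andP[/eqP dji' /eqP[]].
by apply: e_inj; rewrite -dji' di.
Qed.

Theorem theorem1 (R : realType) (X Y : normedModType R) (C E : set X)
    (phi : X -> set Y) :
  cone C -> convex_set C ->
  finite_set E -> cone_basis C E ->
  compact_valued_on C phi -> linear_correspondence C phi ->
  continuous_correspondence C phi.
Proof.
move=> coneC convC finE basisE cphi linphi.
have C0 : C 0.
  have [_ ->] := basisE; exists 0%N, (fun=> 0), (fun=> 0).
  by split=> [[]|[]|] //; rewrite big_ord0.
have [n [e [Ce free_e repr]]] := finite_cone_basis finE basisE.
have [c c0 coord] := coordinate_bound free_e.
have phi_sum l := @image_conic_combination _ _ _ _ _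
  coneC convC C0 cphi linphi n e l Ce.
have /choice[M Mbound] : forall i, exists M, forall u, phi (e i) u -> `|u| <= M.
  move=> i; have [_ /compact_bounded/pinfty_ex_gt0[M _ eM]] := cphi _ (Ce i).
  by exists M.
apply: (@lipschitz_correspondence _ _ _ _ _ (c * \sum_i M i)) => //.
move=> x z w /repr[l l0 ->] /repr[m m0 ->].
have [_ ->] := phi_sum l l0; have [_ ->] := phi_sum m m0.
move=> [u eu <-]; exists (\sum_i m i *: u i); first by exists u.
(* The same [u i] are used for both points, so only coordinates differ. *)
rewrite -!sumrB (le_trans (ler_norm_sum _ _ _))// mulrAC mulr_sumr.
apply: ler_sum => i _; rewrite -scalerBl normrZ ler_pM//.
  have := coord (fun j => l j - m j) i.
  by under eq_bigr => j _ do rewrite scalerBl.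
exact: Mbound.
Qed.
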